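(* Let $H_3(\mathbb{Z})$ be the discrete Heisenberg group, i.e. the group generated by $a$, $b$, $c$ with the relations $c=[a,b]$, $[a,c]=1$ and $[b,c]=1$, equipped with the word metric associated with a finite generating set. Then the asymptotic dimension of $H_3(\mathbb{Z})$ and the Assouad-Nagata dimension of $H_3(\mathbb{Z})$ are both equal to $3$.
   Context: Assouad-Nagata dimension: for a metric space $(X,\rho)$, $\dim_{AN}(X)\leq n$ means that there is a constant $K>0$ such that for every $r>0$ there is a cover $\mathcal{U}_r$ of $X$ whose elements have diameter at most $K\cdot r$ and such that every $r$-ball $B(x,r)$ intersects at most $n+1$ elements of $\mathcal{U}_r$. The Assouad-Nagata dimension is the least such integer $n\geq 0$ (or $\infty$ if there is none). Asymptotic dimension: $\mathrm{asdim}(X)\leq n$ means that for every $r>0$ there is a cover of $X$ by sets of uniformly bounded diameter such that every $r$-ball intersects at most $n+1$ elements of the cover; $\mathrm{asdim}(X)$ is the least such integer $n\ge 0$ (or $\infty$). A finitely generated group is regarded as a metric space via the word metric of a finite generating set. *)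

(* Defs.v *)
From HB Require Import structures.
From mathcomp Require Import all_boot all_order all_algebra.
From mathcomp Require Import all_classical all_reals all_analysis.

Set Implicit Arguments.
Unset Strict Implicit.
Unset Printing Implicit Defensive.
Import Order.TTheory GRing.Theory Num.Theory.
Local Open Scope classical_set_scope.
Local Open Scope ring_scope.

Section Presentation.
Variables (I : choiceType).

(* The letter [(i, false)] is the generator [i], [(i, true)] its formal
   inverse. *)
Definition word := seq (I * bool).

Definition letter_inv (l : I * bool) : I * bool := (l.1, ~~ l.2).
Definition word_inv (w : word) : word := rev (map letter_inv w).
Definition word_comm (u v : word) : word :=
  word_inv u ++ word_inv v ++ u ++ v.

Variable rels : word -> word -> Prop.

(* The congruence on words generated by [rels] and free cancellation. *)
Inductive pres_eq : word -> word -> Prop :=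
| pres_refl u : pres_eq u u
| pres_sym u v : pres_eq u v -> pres_eq v u
| pres_trans u v w : pres_eq u v -> pres_eq v w -> pres_eq u w
| pres_cat u u' v v' :
    pres_eq u u' -> pres_eq v v' -> pres_eq (u ++ v) (u' ++ v')
| pres_cancel l : pres_eq [:: l; letter_inv l] [::]
| pres_rel u v : rels u v -> pres_eq u v.

Definition pres_eqb : rel word := fun u v => `[< pres_eq u v >].

Lemma pres_eqb_refl : reflexive pres_eqb.
Proof. by move=> u; apply/asboolP; exact: pres_refl. Qed.

Lemma pres_eqb_sym : symmetric pres_eqb.
Proof. by move=> u v; apply/asboolP/asboolP; exact: pres_sym. Qed.

Lemma pres_eqb_trans : transitive pres_eqb.
Proof.
by move=> v u w /asboolP uv /asboolP vw; apply/asboolP; exact: pres_trans uv vw.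
Qed.

Canonical pres_equiv :=
  EquivRel pres_eqb pres_eqb_refl pres_eqb_sym pres_eqb_trans.

Definition pres_group : Type := {eq_quot pres_eqb}%qT.
HB.instance Definition _ := Choice.copy pres_group {eq_quot pres_eqb}%qT.

Definition pres_class (u : word) : pres_group :=
  (\pi_{eq_quot pres_eqb} u)%qT.
Definition pres_repr (x : pres_group) : word :=
  repr (x : {eq_quot pres_eqb}%qT).

Definition pres_mul (x y : pres_group) : pres_group :=
  pres_class (pres_repr x ++ pres_repr y).
Definition pres_inv (x : pres_group) : pres_group :=
  pres_class (word_inv (pres_repr x)).
Definition pres_one : pres_group := pres_class [::].

Lemma pres_reprK : cancel pres_repr pres_class.
Proof. exact: reprK. Qed.

Lemma pres_classP (u v : word) : pres_class u = pres_class v <-> pres_eq u v.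
Proof.
split; first by move=> /eqquotP /asboolP.
by move=> uv; apply/eqquotP; apply/asboolP.
Qed.

Lemma letter_invK : involutive letter_inv.
Proof. by case=> i b; rewrite /letter_inv /= negbK. Qed.

Lemma word_invK : involutive word_inv.
Proof.
move=> u; rewrite /word_inv map_rev revK -map_comp -[RHS]map_id.
by apply: eq_map => l /=; exact: letter_invK.
Qed.

Lemma word_inv_cat u v : word_inv (u ++ v) = word_inv v ++ word_inv u.
Proof. by rewrite /word_inv map_cat rev_cat. Qed.

Lemma pres_catV u : pres_eq (u ++ word_inv u) [::].
Proof.
elim: u => [|l u IHu]; first exact: pres_refl.
rewrite -cat1s word_inv_cat !catA -(catA [:: l]).
apply: (pres_trans _ (pres_cancel l)).
rewrite -[X in pres_eq _ X]/([:: l] ++ word_inv [:: l]).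
apply: pres_cat; last exact: pres_refl.
rewrite -[X in pres_eq _ X]cats0.
by apply: pres_cat => //; exact: pres_refl.
Qed.

Lemma pres_Vcat u : pres_eq (word_inv u ++ u) [::].
Proof. by rewrite -{2}[u]word_invK; exact: pres_catV. Qed.

Lemma pres_eq_inv u v : pres_eq u v -> pres_eq (word_inv u) (word_inv v).
Proof.
move=> uv; have r w := pres_refl w.
apply: (@pres_trans _ (word_inv u ++ v ++ word_inv v)).
  rewrite -{1}[word_inv u]cats0; apply: pres_cat => //.
  by apply: pres_sym; exact: pres_catV.
rewrite catA -[X in pres_eq _ X]cat0s; apply: pres_cat => //.
apply: pres_trans (pres_Vcat u).
by apply: pres_cat => //; exact: pres_sym.
Qed.

Lemma pres_mulE u v :
  pres_mul (pres_class u) (pres_class v) = pres_class (u ++ v).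
Proof.
by apply/pres_classP; apply: pres_cat; apply/pres_classP; rewrite pres_reprK.
Qed.

Lemma pres_invE u : pres_inv (pres_class u) = pres_class (word_inv u).
Proof.
by apply/pres_classP; apply: pres_eq_inv; apply/pres_classP; rewrite pres_reprK.
Qed.

Lemma pres_mulA : associative pres_mul.
Proof.
move=> x y z; rewrite -[x]pres_reprK -[y]pres_reprK -[z]pres_reprK.
by rewrite !pres_mulE catA.
Qed.

Lemma pres_mul1 : left_id pres_one pres_mul.
Proof. by move=> x; rewrite -[x]pres_reprK pres_mulE. Qed.

Lemma pres_mulr1 : right_id pres_one pres_mul.
Proof. by move=> x; rewrite -[x]pres_reprK pres_mulE cats0. Qed.

Lemma pres_mulV : left_inverse pres_one pres_inv pres_mul.
Proof.
move=> x; rewrite -[x]pres_reprK pres_invE pres_mulE.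
by apply/pres_classP; exact: pres_Vcat.
Qed.

Lemma pres_mulrV : right_inverse pres_one pres_inv pres_mul.
Proof.
move=> x; rewrite -[x]pres_reprK pres_invE pres_mulE.
by apply/pres_classP; exact: pres_catV.
Qed.

HB.instance Definition _ := isGroup.Build pres_group
  pres_mulA pres_mul1 pres_mulr1 pres_mulV pres_mulrV.

End Presentation.

Definition heis_a : word 'I_3 := [:: (inord 0, false)].
Definition heis_b : word 'I_3 := [:: (inord 1, false)].
Definition heis_c : word 'I_3 := [:: (inord 2, false)].

Inductive heis_rels : word 'I_3 -> word 'I_3 -> Prop :=
| heis_rel_ab : heis_rels heis_c (word_comm heis_a heis_b)
| heis_rel_ac : heis_rels (word_comm heis_a heis_c) [::]
| heis_rel_bc : heis_rels (word_comm heis_b heis_c) [::].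

Definition heisenberg : groupType := pres_group heis_rels.

Section WordMetric.
Variables (G : groupType) (S : set G).
Local Open Scope group_scope.

Definition prod_of_length (n : nat) (g : G) : Prop :=
  exists s : seq G, [/\ size s = n,
    forall x, x \in s -> S x \/ S x^-1 & \prod_(x <- s) x = g].

Definition generates : Prop := forall g : G, exists n, prod_of_length n g.

Hypothesis genS : generates.

Lemma word_norm_ex (g : G) : exists n, `[< prod_of_length n g >].
Proof. by have [n gn] := genS g; exists n; apply/asboolP. Qed.

Definition word_norm (g : G) : nat := ex_minn (word_norm_ex g).

Definition word_dist (g h : G) : nat := word_norm (g^-1 * h).

Lemma word_norm_prod g : prod_of_length (word_norm g) g.
Proof. by rewrite /word_norm; case: ex_minnP => n /asboolP. Qed.

Lemma word_norm_le n g : prod_of_length n g -> (word_norm g <= n)%N.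
Proof.
by rewrite /word_norm; case: ex_minnP => m _ + gn; apply; apply/asboolP.
Qed.

Lemma word_norm1 : word_norm 1 = 0%N.
Proof.
apply/eqP; rewrite -leqn0; apply: word_norm_le.
by exists [::]; split=> //; rewrite big_nil.
Qed.

Lemma word_norm_eq1 g : word_norm g = 0%N -> g = 1.
Proof.
have := word_norm_prod g => /[swap] -> [s [/size0nil -> _ <-]].
by rewrite big_nil.
Qed.

Lemma word_normV_le g : (word_norm g^-1 <= word_norm g)%N.
Proof.
have [s [<- Ss <-]] := word_norm_prod g; apply: word_norm_le.
exists (rev (map (fun x => x^-1) s)); split; first by rewrite size_rev size_map.
  move=> x; rewrite mem_rev => /mapP [y ys ->]; rewrite invgK.
  by case: (Ss y ys); [right|left].
elim: s {Ss} => [|x s IHs]; first by rewrite /= !big_nil invg1.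
by rewrite /= rev_cons -cats1 big_cat /= IHs big_seq1 big_cons invgM.
Qed.

Lemma word_normM g h : (word_norm (g * h) <= word_norm g + word_norm h)%N.
Proof.
have [s [<- Ss <-]] := word_norm_prod g.
have [t [<- St <-]] := word_norm_prod h.
apply: word_norm_le; exists (s ++ t); rewrite size_cat big_cat; split=> // x.
by rewrite mem_cat => /orP[/Ss|/St].
Qed.

Lemma word_distxx g : word_dist g g = 0%N.
Proof. by rewrite /word_dist mulVg word_norm1. Qed.

Lemma word_dist_eq0 g h : word_dist g h = 0%N -> g = h.
Proof. by move=> /word_norm_eq1 /(congr1 (fun x => g * x)); rewrite mulVKg mulg1. Qed.

Lemma word_dist_sym g h : word_dist g h = word_dist h g.
Proof.
have le x y : (word_dist x y <= word_dist y x)%N.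
  by rewrite /word_dist; have := word_normV_le (y^-1 * x); rewrite invgM invgK.
by apply/eqP; rewrite eqn_leq !le.
Qed.

Lemma word_dist_triangle h g k :
  (word_dist g k <= word_dist g h + word_dist h k)%N.
Proof.
rewrite /word_dist; have := word_normM (g^-1 * h) (h^-1 * k).
by rewrite -mulgA mulVKg.
Qed.

End WordMetric.

(* A copy of [G], so that the metric may depend on [R] and [S]. *)
Definition cayley (R : realType) (G : groupType) (S : set G)
  (genS : generates S) : Type := G.

Section CayleyMetric.
Variables (R : realType) (G : groupType) (S : set G) (genS : generates S).
Local Notation X := (cayley R genS).

HB.instance Definition _ := Choice.copy X G.

Definition cayley_dist (x y : X) : R := (word_dist genS x y)%:R.

Lemma cayley_distxx x : cayley_dist x x = 0.
Proof. by rewrite /cayley_dist word_distxx. Qed.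

Lemma cayley_dist_eq0 x y : cayley_dist x y = 0 -> x = y.
Proof.
by move=> /eqP; rewrite /cayley_dist pnatr_eq0 => /eqP /word_dist_eq0.
Qed.

Lemma cayley_dist_sym x y : cayley_dist x y = cayley_dist y x.
Proof. by rewrite /cayley_dist word_dist_sym. Qed.

Lemma cayley_dist_triangle y x z :
  cayley_dist x z <= cayley_dist x y + cayley_dist y z.
Proof. by rewrite /cayley_dist -natrD ler_nat word_dist_triangle. Qed.

HB.instance Definition _ := isMetric.Build R X
  cayley_distxx cayley_dist_eq0 cayley_dist_sym cayley_dist_triangle.

End CayleyMetric.

Section Dimensions.
Variables (R : realType) (X : metricType R).

Definition diam_le (D : R) (U : set X) : Prop :=
  forall x y, U x -> U y -> mdist x y <= D.

Definition is_cover (C : set (set X)) : Prop := \bigcup_(U in C) U = setT.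

Definition ball_multiplicity_le (C : set (set X)) (r : R) (m : nat) : Prop :=
  forall x : X, ([set U | C U /\ ball x r `&` U !=set0] #<= `I_m)%card.

Definition asdim_le (n : nat) : Prop :=
  forall r : R, 0 < r -> exists C : set (set X),
    [/\ is_cover C,
        exists D : R, forall U, C U -> diam_le D U &
        ball_multiplicity_le C r n.+1].

Definition dimAN_le (n : nat) : Prop :=
  exists2 K : R, 0 < K & forall r : R, 0 < r -> exists C : set (set X),
    [/\ is_cover C,
        forall U, C U -> diam_le (K * r) U &
        ball_multiplicity_le C r n.+1].

End Dimensions.

(* The least [n] such that [P n], with [None] standing for infinity. *)
Definition least_dim (P : nat -> Prop) : option nat :=
  match pselect (exists n, `[< P n >]) with
  | left exP => Some (ex_minn exP)
  | right _ => None
  end.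

Definition asdim (R : realType) (X : metricType R) : option nat :=
  least_dim (asdim_le X).

Definition dimAN (R : realType) (X : metricType R) : option nat :=
  least_dim (dimAN_le X).

(* Main.v *)
(* The group is identified with Z^3, (x, y, z) standing for b^y a^x c^z, so that
   heights add up with the twist x y'.  A ball of radius n is, up to constants,
   the box |x|, |y| <= n, |z| <= n^2, because c^(pq) = [a^p, b^q].

   Upper bound, at scale L: over the cells of a brick wall with mesh L in the
   (x, y)-plane, stack bricks of height L^2 / 2.  A ball that is small with
   respect to L sees at most three cells; floors over neighbouring cells are
   offset, so that at a triple point at most one of the three columns shows two
   bricks.  At most 2 + 1 + 1 or 2 + 2 bricks are met.

   Lower bound: a large box of the integer grid is mapped to the group so that
   neighbours stay at bounded distance while opposite faces are far apart.  By
   a cubical Sperner lemma (a discrete Lebesgue covering theorem) some unit cube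
   of the grid meets four members of any uniformly bounded cover. *)
Require Import Defs.
From mathcomp Require Import all_boot all_order all_algebra.
From mathcomp Require Import all_classical all_reals all_analysis.
From mathcomp Require Import zify ring.

Set Implicit Arguments.
Unset Strict Implicit.
Unset Printing Implicit Defensive.
Import Order.TTheory GRing.Theory Num.Theory.
Local Open Scope ring_scope.

(** * Coordinates on the Heisenberg group *)

Section IntegerPowers.
Variable G : groupType.
Implicit Types (g h : G) (n m : int).
Local Open Scope group_scope.

Definition zexpg g n : G :=
  match n with Posz k => g ^+ k | Negz k => g ^- k.+1 end.

Lemma zexpgS g n : zexpg g (n + 1)%R = zexpg g n * g.
Proof.
case: n => [k|[|k]] /=; first by rewrite -expgSr; congr (_ ^+ _); lia.
  by rewrite expg1 mulVg.
by rewrite subn1 [in RHS]expgS invgM mulgVK.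
Qed.

Lemma zexpgP g n : zexpg g (n - 1)%R = zexpg g n * g^-1.
Proof. by rewrite -[X in _ = zexpg g X * _](subrK 1%R) zexpgS mulgK. Qed.

Lemma zexpgD g n m : zexpg g (n + m)%R = zexpg g n * zexpg g m.
Proof.
elim/int_rect: m => [|m IHm|m IHm]; first by rewrite addr0 mulg1.
  by rewrite -addn1 PoszD addrA !zexpgS IHm mulgA.
by rewrite -addn1 PoszD opprD addrA !zexpgP IHm mulgA.
Qed.

Lemma zexpgV g n : zexpg g^-1 n = zexpg g (- n)%R.
Proof.
elim/int_rect: n => [|n IHn|n IHn] //.
  by rewrite -addn1 PoszD opprD zexpgP zexpgS IHn.
by rewrite -addn1 PoszD opprD zexpgP IHn invgK opprD opprK zexpgS.
Qed.

Lemma zexpgMn g h n : commute g h -> zexpg (g * h) n = zexpg g n * zexpg h n.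
Proof.
move=> gh; case: n => k /=; first exact: expgMn.
by rewrite expgMn // -invgM; congr _^-1; apply: commuteX2.
Qed.

Lemma zexpgJ g h n : zexpg (g ^ h) n = zexpg g n ^ h.
Proof. by case: n => k /=; rewrite ?conjVg conjXg. Qed.

Lemma commute_zexpg g h n : commute g h -> commute g (zexpg h n).
Proof. by case: n => k gh /=; [|apply: commuteV]; exact: commuteX. Qed.

End IntegerPowers.

Section HeisenbergCoordinates.

(** The product of unitriangular 3 x 3 integer matrices with [x], [y] above the diagonal and [z] in
    the corner. *)
Definition hmul (p q : int * int * int) : int * int * int :=
  (p.1.1 + q.1.1, p.1.2 + q.1.2, p.2 + q.2 + p.1.1 * q.1.2).

Lemma hmulA : associative hmul.
Proof.
move=> [[x y] z] [[x' y'] z'] [[x'' y''] z''].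
by rewrite /hmul /=; congr (_, _, _); ring.
Qed.

Lemma hmul0p : left_id (0, 0, 0) hmul.
Proof. by move=> [[x y] z]; rewrite /hmul /= !add0r mul0r addr0. Qed.

Definition letter_coord (l : 'I_3 * bool) : int * int * int :=
  let s : int := (-1) ^+ l.2 in
  (if l.1 == inord 0 then s else 0, if l.1 == inord 1 then s else 0,
   if l.1 == inord 2 then s else 0).

Definition word_coord (w : word 'I_3) : int * int * int :=
  foldr (fun l => hmul (letter_coord l)) (0, 0, 0) w.

Lemma word_coord_cat u v : word_coord (u ++ v) = hmul (word_coord u) (word_coord v).
Proof.
by elim: u => [|l u IHu] /=; rewrite ?hmul0p // IHu hmulA.
Qed.

Let inordE (i j : nat) : (i < 3)%N -> (j < 3)%N ->
  (inord i == inord j :> 'I_3) = (i == j).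
Proof. by move=> ? ?; rewrite -val_eqE /= !inordK. Qed.

Lemma ord3_ind (P : 'I_3 -> Prop) :
  P (inord 0) -> P (inord 1) -> P (inord 2) -> forall i, P i.
Proof.
move=> P0 P1 P2 [[|[|[|//]]] lti]; [move: P0|move: P1|move: P2];
by congr P; apply: val_inj; rewrite /= inordK.
Qed.

Lemma word_coord_pres u v : pres_eq heis_rels u v -> word_coord u = word_coord v.
Proof.
elim=> //.
- by move=> w1 w2 w3 _ -> _ ->.
- by move=> w1 w1' w2 w2' _ e1 _ e2; rewrite !word_coord_cat e1 e2.
- case=> i s; elim/ord3_ind: i; case: s;
  by rewrite /word_coord /= /letter_coord /letter_inv /= !inordE.
- by move=> _ _ []; rewrite /word_coord /= /letter_coord /letter_inv /= !inordE.
Qed.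

Definition hcoord (g : heisenberg) := word_coord (pres_repr g).
Definition hx g := (hcoord g).1.1.
Definition hy g := (hcoord g).1.2.
Definition hz g := (hcoord g).2.

Lemma hcoord_class w : hcoord (pres_class heis_rels w) = word_coord w.
Proof. by apply: word_coord_pres; apply/pres_classP; rewrite pres_reprK. Qed.

Lemma hcoordM g h : hcoord (g * h)%g = hmul (hcoord g) (hcoord h).
Proof.
by rewrite -[g]pres_reprK -[h]pres_reprK [(_ * _)%g]pres_mulE !hcoord_class
   word_coord_cat.
Qed.

Lemma hxM g h : hx (g * h)%g = hx g + hx h.
Proof. by rewrite /hx hcoordM. Qed.

Lemma hyM g h : hy (g * h)%g = hy g + hy h.
Proof. by rewrite /hy hcoordM. Qed.

Lemma hzM g h : hz (g * h)%g = hz g + hz h + hx g * hy h.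
Proof. by rewrite /hz hcoordM. Qed.

Lemma hcoord1 : hcoord 1%g = (0, 0, 0).
Proof. exact: (hcoord_class [::]). Qed.

Lemma hx1 : hx 1%g = 0. Proof. by rewrite /hx hcoord1. Qed.
Lemma hy1 : hy 1%g = 0. Proof. by rewrite /hy hcoord1. Qed.
Lemma hz1 : hz 1%g = 0. Proof. by rewrite /hz hcoord1. Qed.

Lemma hxV g : hx g^-1%g = - hx g.
Proof. by have := hxM g g^-1%g; rewrite mulgV hx1; lia. Qed.

Lemma hyV g : hy g^-1%g = - hy g.
Proof. by have := hyM g g^-1%g; rewrite mulgV hy1; lia. Qed.

Lemma hzV g : hz g^-1%g = - hz g + hx g * hy g.
Proof. by have := hzM g g^-1%g; rewrite mulgV hz1 hyV; lia. Qed.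

Lemma hx_div g h : hx (g^-1 * h)%g = hx h - hx g.
Proof. by rewrite hxM hxV addrC. Qed.

Lemma hy_div g h : hy (g^-1 * h)%g = hy h - hy g.
Proof. by rewrite hyM hyV addrC. Qed.

Lemma hz_div g h : hz (g^-1 * h)%g = hz h - hz g - hx g * (hy h - hy g).
Proof. by rewrite hzM hzV hxV; ring. Qed.

Definition gen_a : heisenberg := pres_class heis_rels heis_a.
Definition gen_b : heisenberg := pres_class heis_rels heis_b.
Definition gen_c : heisenberg := pres_class heis_rels heis_c.

Lemma pres_class_comm u v :
  pres_class heis_rels (word_comm u v) =
  [~ (pres_class heis_rels u : heisenberg), pres_class heis_rels v]%g.
Proof.
rewrite /commg /conjg [(_^-1)%g]pres_invE [X in (_ * (X * _))%g]pres_invE.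
rewrite [X in (_ * (_ * X))%g]pres_mulE [X in (_ * X)%g]pres_mulE.
by rewrite [RHS]pres_mulE.
Qed.

Lemma gen_ab : [~ gen_a, gen_b]%g = gen_c.
Proof.
rewrite -pres_class_comm; apply/pres_classP/pres_sym/pres_rel.
exact: heis_rel_ab.
Qed.

Lemma gen_ac : commute gen_a gen_c.
Proof.
apply/commgP/eqP; rewrite -pres_class_comm; apply/pres_classP/pres_rel.
exact: heis_rel_ac.
Qed.

Lemma gen_bc : commute gen_b gen_c.
Proof.
apply/commgP/eqP; rewrite -pres_class_comm; apply/pres_classP/pres_rel.
exact: heis_rel_bc.
Qed.

Lemma conj_ab : (gen_a ^ gen_b)%g = (gen_a * gen_c)%g.
Proof. by rewrite -gen_ab commgEl mulVKg. Qed.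

Lemma conj_abV : (gen_a ^ gen_b^-1)%g = (gen_a * gen_c^-1)%g.
Proof.
apply: (@conjg_inj _ gen_b); rewrite conjgKV conjMg conjVg conj_ab.
have /conjg_fixP -> : [~ gen_c, gen_b]%g == 1%g.
  by apply/commgP/commute_sym/gen_bc.
by rewrite mulgK.
Qed.

(** With [b] in front of [a] the coordinates are exactly [(x, y, z)]; the opposite order would add
    [x * y] to the height. *)
Definition helt (x y z : int) : heisenberg :=
  (zexpg gen_b y * zexpg gen_a x * zexpg gen_c z)%g.

Lemma helt0 : helt 0 0 0 = 1%g.
Proof. by rewrite /helt /= !expg0 !mulg1. Qed.

(** As [c] is central, only [b] and its inverse cross a power that they do not commute with:
    [a^x b = b (a c)^x = b a^x c^x], the twist of [hmul]. *)
Lemma helt_cat g l x y z : g = helt x y z ->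
  (g * pres_class heis_rels [:: l])%g =
  let p := hmul (x, y, z) (letter_coord l) in helt p.1.1 p.1.2 p.2.
Proof.
move=> ->; case: l => i s.
have cz h n : commute h gen_c -> (zexpg gen_c n * h = h * zexpg gen_c n)%g.
  by move=> /(@commute_zexpg _ _ _ n) ->.
have cls j : pres_class heis_rels [:: (j, true)] =
    (pres_class heis_rels [:: (j, false)])^-1%g :> heisenberg.
  by rewrite [RHS]pres_invE.
elim/ord3_ind: i; rewrite /hmul /letter_coord /= !inordE //=; case: s;
  rewrite ?cls /= !(addr0, mulr0) /helt -mulgA.
- rewrite (cz gen_a^-1%g); last by apply/commute_sym/commuteV/commute_sym/gen_ac.
  by rewrite zexpgP !mulgA.
- by rewrite (cz gen_a _ gen_ac) zexpgS !mulgA.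
- rewrite (cz gen_b^-1%g); last by apply/commute_sym/commuteV/commute_sym/gen_bc.
  rewrite mulgA -(mulgA _ (zexpg gen_a x)) [(zexpg gen_a x * _)%g]conjgC -zexpgJ conj_abV.
  rewrite zexpgMn ?zexpgP; last by apply/commuteV/gen_ac.
  by rewrite mulrN1 addrC zexpgD zexpgV !mulgA.
- rewrite (cz gen_b _ gen_bc).
  rewrite mulgA -(mulgA _ (zexpg gen_a x)) [(zexpg gen_a x * _)%g]conjgC -zexpgJ conj_ab.
  rewrite zexpgMn ?zexpgS; last by apply/gen_ac.
  by rewrite mulr1 addrC zexpgD !mulgA.
- by rewrite zexpgP !mulgA.
- by rewrite zexpgS !mulgA.
Qed.

(** Words are brought to normal form letter by letter from the left. So the coordinates are
    injective, and identities in the group can be checked on them. *)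
Lemma heltK g : helt (hx g) (hy g) (hz g) = g.
Proof.
rewrite /hx /hy /hz /hcoord -[RHS]pres_reprK; elim/last_ind: (pres_repr g) => [|w l IHw].
  by rewrite helt0.
rewrite -cats1 -[RHS]pres_mulE word_coord_cat.
rewrite [RHS](@helt_cat _ l _ _ _ (esym IHw)) /word_coord /=.
by rewrite /hmul /= !addr0 mulr0 addr0.
Qed.

Lemma hcoord_gen : [/\ hcoord gen_a = (1, 0, 0), hcoord gen_b = (0, 1, 0) &
  hcoord gen_c = (0, 0, 1)].
Proof.
by split; rewrite hcoord_class /word_coord /= /letter_coord /= !inordE.
Qed.

(** The height of an [n]-th power has the extra term [n (n - 1) / 2] times [hx g * hy g]; the
    hypothesis kills it. *)
Lemma hcoord_zexpg g (n : int) : hx g * hy g = 0 ->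
  hcoord (zexpg g n) = (n * hx g, n * hy g, n * hz g).
Proof.
move=> xy0; elim/int_rect: n => [|n IHn|n IHn]; first by rewrite !mul0r hcoord1.
  rewrite -addn1 PoszD zexpgS hcoordM IHn /hmul /= -/(hx g) -/(hy g) -/(hz g).
  by rewrite -mulrA xy0; congr (_, _, _); ring.
rewrite -addn1 PoszD opprD zexpgP hcoordM IHn /hmul /=.
rewrite -/(hx g^-1%g) -/(hy g^-1%g) -/(hz g^-1%g) hxV hyV hzV.
by rewrite mulrN -mulrA xy0; congr (_, _, _); ring.
Qed.

Lemma hcoord_helt x y z : hcoord (helt x y z) = (x, y, z).
Proof.
have [ea eb ec] := hcoord_gen.
rewrite /helt !hcoordM !hcoord_zexpg /hx /hy /hz ?ea ?eb ?ec //=.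
by rewrite /hmul /=; congr (_, _, _); ring.
Qed.

End HeisenbergCoordinates.

(** * Word norm and coordinates *)

Section PowerNorm.
Variables (G : groupType) (S : set G) (genS : generates S).
Local Notation norm := (word_norm genS).

Lemma word_norm_expg g n : (norm (g ^+ n)%g <= n * norm g)%N.
Proof.
elim: n => [|n IHn]; first by rewrite expg0 word_norm1.
by rewrite expgS mulSn (leq_trans (word_normM _ _ _)) // leq_add2l.
Qed.

Lemma word_norm_zexpg g (n : int) : (norm (zexpg g n) <= `|n| * norm g)%N.
Proof.
case: n => n /=; first exact: word_norm_expg.
exact: leq_trans (word_normV_le _ _) (word_norm_expg _ _).
Qed.

End PowerNorm.

Section WordNorm.
Variables (S : set heisenberg) (genS : generates S).
Hypothesis finS : finite_set S.
Local Notation norm := (word_norm genS).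

(* A central element [c^(p m + t)] is [[a^p, b^m] c^t], which is why height
   [m^2] costs only a multiple of [m]. *)
Lemma word_norm_le_coord : exists C : nat, forall (g : heisenberg) (m : nat),
  (0 < m)%N -> `|hx g| <= m%:Z -> `|hy g| <= m%:Z -> `|hz g| <= m%:Z ^+ 2 ->
  (norm g <= C * m)%N.
Proof.
(* The word below has three powers of [a], three of [b] and one of [c], all with exponents at most
   [m] in absolute value. *)
exists (3 * norm gen_a + 3 * norm gen_b + norm gen_c)%N => g m m0 xm ym zm.
pose p := (hz g %/ m)%Z; pose t := (hz g %% m)%Z.
have zE : hz g = p * m + t := divz_eq _ _.
have t0 : 0 <= t by rewrite modz_ge0 //; lia.
have tm : t < m by rewrite ltz_pmod.
have pm : `|p| <= m%:Z by nia.
pose a n := zexpg gen_a n; pose b n := zexpg gen_b n.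
(* The commutator of [a^p] and [b^m] supplies the height [p * m], and [c^t] the remainder. *)
have gE : g = (b (hy g) * (a (hx g) *
    (a (- p) * (b (- m%:Z) * (a p * (b m * zexpg gen_c t))))))%g.
  have [ea eb ec] := hcoord_gen.
  rewrite -[LHS]heltK -[RHS]heltK.
  rewrite /hx /hy /hz !hcoordM !hcoord_zexpg /hx /hy /hz ?ea ?eb ?ec //=.
  rewrite -/(hx g) -/(hy g) -/(hz g) zE /hmul /=; congr helt; ring.
rewrite gE; have nM h k l : (norm k <= l -> norm (h * k)%g <= norm h + l)%N.
  by move=> kl; apply: leq_trans (word_normM _ _ _) _; rewrite leq_add2l.
apply: leq_trans (nM _ _ _ (nM _ _ _ (nM _ _ _ (nM _ _ _ (nM _ _ _
  (word_normM _ _ _)))))) _.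
have na n : (norm (a n) <= `|n| * norm gen_a)%N by exact: word_norm_zexpg.
have nb n : (norm (b n) <= `|n| * norm gen_b)%N by exact: word_norm_zexpg.
have nc n : (norm (zexpg gen_c n) <= `|n| * norm gen_c)%N by exact: word_norm_zexpg.
have le k h : `|k| <= m%:Z -> (`|k| * norm h <= m * norm h)%N.
  by move=> km; rewrite leq_mul2r; apply/orP; right; lia.
have := conj (na (hx g)) (le (hx g) gen_a xm).
have := conj (na p) (le p gen_a pm).
have := conj (na (- p)) (le (- p) gen_a ltac:(lia)).
have := conj (nb (hy g)) (le (hy g) gen_b ym).
have := conj (nb m) (le m gen_b ltac:(lia)).
have := conj (nb (- m%:Z)) (le (- m%:Z) gen_b ltac:(lia)).
have := conj (nc t) (le t gen_c ltac:(lia)).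
lia.
Qed.

Lemma finite_coord_bound : exists B : nat, forall g, S g ->
  [/\ `|hx g| <= B%:Z, `|hy g| <= B%:Z & `|hz g| <= B%:Z].
Proof.
have /finite_seqP [s ->] := finS.
elim: s => [|h s [B IHs]]; first by exists 0%N.
exists (B + `|hx h| + `|hy h| + `|hz h|)%N => g /=; rewrite inE => /predU1P [->|/IHs []].
  by split; lia.
by split; lia.
Qed.

(** Each generator changes [x] and [y] by a bounded amount, and the height by an amount linear in
    the length so far, hence the quadratic bound. *)
Lemma coord_le_word_norm : exists C : nat, forall g (n : nat), (norm g <= n)%N ->
  [/\ `|hx g| <= C%:Z * n, `|hy g| <= C%:Z * n & `|hz g| <= (C%:Z * n) ^+ 2].
Proof.
have [B SB] := finite_coord_bound.
(* The square is for inverses, whose height [- z + x y] has a quadratic term. *)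
pose D := B%:Z + B%:Z ^+ 2.
have D0 : 0 <= D by rewrite /D; nia.
have SD g : S g \/ S g^-1%g -> [/\ `|hx g| <= D, `|hy g| <= D & `|hz g| <= D].
  have B2 : 0 <= B%:Z ^+ 2 by exact: sqr_ge0.
  case=> [/SB [*]|]; first by rewrite /D; split; lia.
  rewrite -{2 3 4}[g]invgK; move: (g^-1)%g => h /SB [xB yB zB].
  have xyB : `|hx h * hy h| <= B%:Z ^+ 2 by rewrite normrM expr2 ler_pM.
  by rewrite hxV hyV hzV /D; split; lia.
exists (`|D| + 1)%N => g n.
have -> : (`|D| + 1)%N%:Z = D + 1 by lia.
(* The linear term makes the induction go through; replacing [D] by [D + 1] absorbs it. *)
move=> gn; suff [xn yn zn] : [/\ `|hx g| <= D * n, `|hy g| <= D * n &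
    `|hz g| <= D * n + (D * n) ^+ 2].
  have -> : (D + 1) * n = D * n + n by ring.
  have q0 : 0 <= D * n by apply: mulr_ge0.
  have qn : D * n <= D * n * n.
    by case: (n) => [|k]; rewrite ?mulr0 ?mul0r // ler_peMr // mulr_ge0.
  rewrite sqrrD; have n2 : 0 <= n%:Z ^+ 2 by exact: sqr_ge0.
  by split; lia.
have [s [sz Ss <-]] := word_norm_prod genS g; move: gn; rewrite -sz => {sz}.
elim: s n Ss => [|h s IHs] n Ss sn; first by rewrite big_nil hx1 hy1 hz1; split; nia.
case: n sn => // n sn; rewrite big_cons hxM hyM hzM.
have [x1 y1 z1] := SD h (Ss _ (mem_head _ _)).
have [|x2 y2 z2] := IHs n _ sn; first by move=> x xs; apply: Ss; rewrite inE xs orbT.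
move: (\big[_/_]_(_ <- _) _) x2 y2 z2 => g' x2 y2 z2.
have e : D * n.+1 = D * n + D by rewrite -addn1 PoszD; ring.
rewrite e; have n0 : 0 <= D * n by apply: mulr_ge0.
have xy : `|hx h * hy g'| <= D * (D * n) by rewrite normrM ler_pM.
have -> : (D * n + D) ^+ 2 = (D * n) ^+ 2 + 2 * (D * (D * n)) + D ^+ 2 by ring.
have D2 : 0 <= D ^+ 2 by exact: sqr_ge0.
have Dn : 0 <= D * (D * n) by exact: mulr_ge0.
by split; lia.
Qed.

End WordNorm.

(** * A cubical Sperner lemma *)

Section CubicalSperner.

(* [cell1], [cell2], [cell3] are determinants in the indicators of the labels:
   they vanish unless the vertices carry exactly the labels [0 .. d], each
   is, up to sign, the coboundary of the previous one on the labels [0 .. d],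
   and so the count of fully labelled cells telescopes to the boundary. *)
Definition is_label (c p : nat) : int := (p == c)%:R.

Definition cell1 (p q : nat) : int :=
  is_label 0 p * is_label 1 q - is_label 1 p * is_label 0 q.

Definition cell2 (p q r : nat) : int :=
  cell1 p q * is_label 2 r - cell1 p r * is_label 2 q + cell1 q r * is_label 2 p.

Definition cell3 (p q r s : nat) : int :=
  cell2 p q r * is_label 3 s - cell2 p q s * is_label 3 r
  + cell2 p r s * is_label 3 q - cell2 q r s * is_label 3 p.

Lemma sum_is_label p : (p < 4)%N ->
  is_label 3 p = 1 - is_label 0 p - is_label 1 p - is_label 2 p.
Proof. by case: p => [|[|[|[|]]]]. Qed.

Lemma cell1_exact p q : (p < 2)%N -> (q < 2)%N ->
  cell1 p q = is_label 0 p - is_label 0 q.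
Proof. by case: p => [|[|]] //; case: q => [|[|]]. Qed.

Lemma cell2_exact p q r : (p < 3)%N -> (q < 3)%N -> (r < 3)%N ->
  cell2 p q r = cell1 q r - cell1 p r + cell1 p q.
Proof.
by case: p => [|[|[|]]] //; case: q => [|[|[|]]] //; case: r => [|[|[|]]].
Qed.

(** The indicators of the four labels sum to 1, so the last row of the determinant may be replaced
    by ones; expanding along it gives the faces. *)
Lemma cell3_exact p q r s : (p < 4)%N -> (q < 4)%N -> (r < 4)%N -> (s < 4)%N ->
  cell3 p q r s = cell2 p q r - cell2 p q s + cell2 p r s - cell2 q r s.
Proof.
move=> p4 q4 r4 s4; rewrite /cell3 !sum_is_label // /cell2 /cell1; ring.
Qed.

(** The row of the missing label is zero in the determinant. *)
Lemma cell1_eq0 c p q : (c < 2)%N -> p != c -> q != c -> cell1 p q = 0.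
Proof.
by case: c => [|[|]] // _ /negPf cp /negPf cq;
  rewrite /cell1 /is_label cp cq ?(mulr0, mul0r) ?subrr.
Qed.

Lemma cell2_eq0 c p q r : (c < 3)%N -> p != c -> q != c -> r != c ->
  cell2 p q r = 0.
Proof.
rewrite ltnS leq_eqVlt => /orP [/eqP ->|c2] cp cq cr; rewrite /cell2.
  by rewrite /is_label (negPf cp) (negPf cq) (negPf cr) !mulr0 ?subrr ?addr0.
by rewrite !(cell1_eq0 c2) // !mul0r ?subrr ?addr0.
Qed.

Lemma cell3_eq0 c p q r s : (c < 4)%N -> p != c -> q != c -> r != c -> s != c ->
  cell3 p q r s = 0.
Proof.
rewrite ltnS leq_eqVlt => /orP [/eqP ->|c3] cp cq cr cs; rewrite /cell3.
  rewrite /is_label (negPf cp) (negPf cq) (negPf cr) (negPf cs) !mulr0.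
  by rewrite ?(subrr, addr0).
by rewrite !(cell2_eq0 c3) // !mul0r ?(subrr, addr0).
Qed.

Lemma telescope_ord (n : nat) (f : nat -> int) :
  \sum_(i < n) (f i.+1 - f i) = f n - f 0%N.
Proof.
by rewrite -(big_mkord xpredT (fun i => f i.+1 - f i)) telescope_sumr.
Qed.

(** The face [k = n3] carries labels below 3, its edge [j = n2] only 0 and 1, and the ends of this
    edge 1 and 0. Every other face misses one of 0, 1, 2. *)
Variables (n1 n2 n3 : nat) (l : nat -> nat -> nat -> nat).
Hypothesis l_lt4 : forall i j k, (i <= n1)%N -> (j <= n2)%N -> (k <= n3)%N ->
  (l i j k < 4)%N.
Hypothesis l_x0 : forall j k, (j <= n2)%N -> (k <= n3)%N -> (0 < l 0 j k)%N.
Hypothesis l_x1 : forall j k, (j <= n2)%N -> (k <= n3)%N -> l n1 j k != 1%N.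
Hypothesis l_y0 : forall i k, (i <= n1)%N -> (k <= n3)%N -> (1 < l i 0 k)%N.
Hypothesis l_y1 : forall i k, (i <= n1)%N -> (k <= n3)%N -> l i n2 k != 2%N.
Hypothesis l_z0 : forall i j, (i <= n1)%N -> (j <= n2)%N -> (2 < l i j 0)%N.
Hypothesis l_z1 : forall i j, (i <= n1)%N -> (j <= n2)%N -> l i j n3 != 3%N.

(** Kuhn triangulation: squares are cut by a diagonal into two triangles, cubes into six tetrahedra
    around the main diagonal, with orientation signs. *)
Let Xe i j k := cell1 (l i j k) (l i.+1 j k).
Let Ye i j k := cell1 (l i j k) (l i j.+1 k).
Let XYf i j k := cell2 (l i j k) (l i.+1 j k) (l i.+1 j.+1 k)
  - cell2 (l i j k) (l i j.+1 k) (l i.+1 j.+1 k).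
Let XZf i j k := cell2 (l i j k) (l i.+1 j k) (l i.+1 j k.+1)
  - cell2 (l i j k) (l i j k.+1) (l i.+1 j k.+1).
Let YZf i j k := cell2 (l i j k) (l i j.+1 k) (l i j.+1 k.+1)
  - cell2 (l i j k) (l i j k.+1) (l i j.+1 k.+1).
Let cube i j k :=
  let o := l i j k in let t := l i.+1 j.+1 k.+1 in
  cell3 o (l i.+1 j k) (l i.+1 j.+1 k) t - cell3 o (l i.+1 j k) (l i.+1 j k.+1) t
  - cell3 o (l i j.+1 k) (l i.+1 j.+1 k) t + cell3 o (l i j.+1 k) (l i j.+1 k.+1) t
  + cell3 o (l i j k.+1) (l i.+1 j k.+1) t - cell3 o (l i j k.+1) (l i j.+1 k.+1) t.

(** Each inner triangle belongs to two tetrahedra with opposite signs, so only the six faces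
    survive. The sign on the left makes the total count 1. *)
Let cubeE i j k : (i < n1)%N -> (j < n2)%N -> (k < n3)%N ->
  - cube i j k = (YZf i.+1 j k - YZf i j k) - (XZf i j.+1 k - XZf i j k)
    + (XYf i j k.+1 - XYf i j k).
Proof.
move=> li lj lk.
rewrite /cube /= !cell3_exact ?l_lt4 //; try by rewrite ltnW.
rewrite /XYf /XZf /YZf; ring.
Qed.

Let lt3 i j : (i <= n1)%N -> (j <= n2)%N -> (l i j n3 < 3)%N.
Proof.
by move=> li lj; rewrite ltn_neqAle l_z1 //= -ltnS l_lt4.
Qed.

Let lt2 i : (i <= n1)%N -> (l i n2 n3 < 2)%N.
Proof. by move=> li; rewrite ltn_neqAle l_y1 //= -ltnS lt3. Qed.

Let XYfE i j : (i < n1)%N -> (j < n2)%N ->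
  XYf i j n3 = (Ye i.+1 j n3 - Ye i j n3) - (Xe i j.+1 n3 - Xe i j n3).
Proof.
move=> li lj; rewrite /XYf !cell2_exact ?lt3 //; try by rewrite ltnW.
rewrite /Xe /Ye; ring.
Qed.

Let sum_Xe : \sum_(i < n1) Xe i n2 n3 = -1.
Proof.
rewrite -[LHS]opprK -sumrN.
under eq_bigr => i _.
  rewrite /Xe cell1_exact ?lt2 //; last exact: ltnW.
  rewrite opprB; over.
rewrite (telescope_ord n1 (fun i => is_label 0 (l i n2 n3))) /is_label.
have := l_x0 (leqnn n2) (leqnn n3); rewrite lt0n => /negPf ->.
have := lt2 (leqnn n1); have := l_x1 (leqnn n2) (leqnn n3).
by case: (l n1 n2 n3) => [|[|]].
Qed.

Let sum_XYf : \sum_(i < n1) \sum_(j < n2) XYf i j n3 = 1.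
Proof.
under eq_bigr => i _.
  under eq_bigr => j _ do rewrite XYfE //.
  rewrite sumrB (telescope_ord n2 (fun j => Xe i j n3)); over.
rewrite sumrB [X in _ - X]sumrB sum_Xe exchange_big big1 => [|j _].
  rewrite big1 ?sub0r ?opprB ?opprK ?subr0 // => i _.
  by apply: (@cell1_eq0 0); rewrite // -lt0n ltnW // l_y0 // ltnW.
rewrite (telescope_ord n1 (fun i => Ye i j n3)) /Ye.
rewrite (@cell1_eq0 1) ?l_x1 //; last exact: ltnW.
by rewrite (@cell1_eq0 0) ?subrr // -lt0n l_x0 // ltnW.
Qed.

Let sum_cube : \sum_(i < n1) \sum_(j < n2) \sum_(k < n3) - cube i j k = 1.
Proof.
under eq_bigr => i _.
  under eq_bigr => j _.
    under eq_bigr => k _ do rewrite cubeE //.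
    rewrite big_split sumrB (telescope_ord n3 (fun k => XYf i j k)) /=; over.
  rewrite big_split sumrB; over.
rewrite big_split sumrB /=.
(* After telescoping, the side faces and the bottom contribute nothing, each missing one of the
   labels 0, 1, 2; the top face remains. *)
rewrite exchange_big big1 => [|j _].
  rewrite [X in _ - X]big1 => [|i _].
    rewrite subrr add0r -sum_XYf; apply: eq_bigr => i _; apply: eq_bigr => j _.
    have := (l_z0 (ltnW (ltn_ord i)) (ltnW (ltn_ord j)), l_z0 (ltn_ord i) (ltnW (ltn_ord j)),
      l_z0 (ltnW (ltn_ord i)) (ltn_ord j), l_z0 (ltn_ord i) (ltn_ord j)).
    by case=> [[[? ?] ?] ?]; rewrite [XYf i j 0]/XYf !(@cell2_eq0 0) ?subr0 // -lt0n; lia.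
  rewrite exchange_big big1 // => k _; rewrite (telescope_ord n2 (fun j => XZf i j k)) /XZf.
  have := (l_y1 (ltnW (ltn_ord i)) (ltnW (ltn_ord k)), l_y1 (ltn_ord i) (ltnW (ltn_ord k)),
      l_y1 (ltnW (ltn_ord i)) (ltn_ord k), l_y1 (ltn_ord i) (ltn_ord k)).
  case=> [[[? ?] ?] ?]; rewrite !(@cell2_eq0 2 (l _ n2 _)) //.
  have := (l_y0 (ltnW (ltn_ord i)) (ltnW (ltn_ord k)), l_y0 (ltn_ord i) (ltnW (ltn_ord k)),
      l_y0 (ltnW (ltn_ord i)) (ltn_ord k), l_y0 (ltn_ord i) (ltn_ord k)).
  by case=> [[[? ?] ?] ?]; rewrite !(@cell2_eq0 0) ?subrr // -lt0n; lia.
rewrite exchange_big big1 // => k _; rewrite (telescope_ord n1 (fun i => YZf i j k)) /YZf.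
have ltW n (i : 'I_n) := ltnW (ltn_ord i).
rewrite !(@cell2_eq0 1 (l n1 _ _)) ?l_x1 ?ltW //.
by rewrite !(@cell2_eq0 0) ?subrr // -lt0n l_x0 ?ltW.
Qed.

(** A cube that misses a label contributes 0, while the total is 1. *)
Lemma cubical_sperner : exists i j k, [/\ (i < n1)%N, (j < n2)%N, (k < n3)%N &
  forall c, (c < 4)%N -> exists e1 e2 e3 : bool, l (i + e1) (j + e2) (k + e3) = c].
Proof.
apply: contrapT => noc; suff : (1 : int) = 0 by [].
rewrite -sum_cube big1 // => i _; rewrite big1 // => j _; rewrite big1 // => k _.
have [c [c4 cc]] : exists c, (c < 4)%N /\
    forall e1 e2 e3 : bool, l (i + e1) (j + e2) (k + e3) != c.
  apply: contrapT => nc; apply: noc; exists i, j, k; split=> // c c4.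
  apply: contrapT => nex; apply: nc; exists c; split=> // e1 e2 e3.
  by apply/eqP => lc; apply: nex; exists e1, e2, e3.
have {}cc e1 e2 e3 := cc e1 e2 e3.
have := (cc false false false, cc false false true, cc false true false,
  cc false true true, cc true false false, cc true false true, cc true true false,
  cc true true true); rewrite /= !(addn0, addn1) => -[[[[[[[? ?] ?] ?] ?] ?] ?] ?].
by rewrite /cube /= !(@cell3_eq0 c) // !(subrr, addr0) oppr0.
Qed.

End CubicalSperner.

(** * Lower bound *)

Section LowerBound.
Variables (R : realType) (S : set heisenberg) (genS : generates S).
Hypothesis finS : finite_set S.
Local Notation norm := (word_norm genS).

(* Moving [y] by one unit at abscissa [i] shears the height by [i]; each unit
   of [y] is therefore cut into [N] steps, over which the shear is spread, so
   that neighbouring grid points stay at bounded distance. *)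
Definition grid_point (N i j k : nat) : heisenberg :=
  helt i%:Z (j %/ N)%N%:Z (k%:Z - (i * (j %% N) %/ N)%N%:Z).

Lemma grid_point_coord N i j k : hcoord (grid_point N i j k) =
  (i%:Z, (j %/ N)%N%:Z, k%:Z - (i * (j %% N) %/ N)%N%:Z).
Proof. exact: hcoord_helt. Qed.

(** Inside a block of [N] steps the accumulated shear moves by at most 2. At the end of a block it
    returns to 0, which offsets the twist caused by the unit step in [y]. *)
Lemma grid_point_step N i j k (e1 e2 e3 : bool) : (i < N)%N ->
  let g := grid_point N i j k in let h := grid_point N (i + e1) (j + e2) (k + e3) in
  [/\ `|hx (g^-1 * h)%g| <= 2, `|hy (g^-1 * h)%g| <= 2 & `|hz (g^-1 * h)%g| <= 2 ^+ 2].
Proof.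
move=> iN g h; rewrite hx_div hy_div hz_div /hx /hy /hz !grid_point_coord /= {g h}.
have N0 : (0 < N)%N by lia.
have tN : (j %% N < N)%N by rewrite ltn_mod.
have := divn_eq j N; set q := (j %/ N)%N; set t := (j %% N)%N => jE.
have fl (m : nat) : (m %/ N * N <= m < (m %/ N).+1 * N)%N by rewrite leq_divM ltn_ceil.
have := fl (i * t)%N; set f := (i * t %/ N)%N => f_it.
have [tS|tS] := ltnP (t + e2) N.
  have -> : ((j + e2) %/ N = q)%N by rewrite jE -addnA divnMDl // divn_small ?addn0.
  have -> : ((j + e2) %% N = t + e2)%N by rewrite jE -addnA modnMDl modn_small.
  have := fl ((i + e1) * (t + e2))%N; set f' := (_ %/ N)%N => f'_it.
  have lo : (i * t <= (i + e1) * (t + e2))%N by rewrite leq_mul // leq_addr.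
  have hi : ((i + e1) * (t + e2) <= i * t + 2 * N)%N.
    by case: e1 e2 {f' f'_it lo tS} => [] [];
      rewrite ?(addn0, addn1) ?mulSn ?mulnS; lia.
  have h1 : (f <= f')%N by nia.
  have h2 : (f' <= f + 2)%N by nia.
  by split; case: e1 {f' f'_it lo hi h1 h2} (f') h1 h2 => f' h1 h2; lia.
(* End of a block: the twist is [i], and the shear [f] to be dropped is [i] or [i - 1]. *)
have tE : (t + e2 = N)%N by lia.
have -> : ((j + e2) %/ N = q + 1)%N.
  by rewrite jE -addnA tE divnMDl // divnn N0.
have -> : ((j + e2) %% N = 0)%N.
  by rewrite jE -addnA tE modnMDl modnn.
have {}tE : (t = N.-1)%N by case: (e2) tE; lia.
rewrite muln0 div0n.
have h1 : (f <= i)%N by nia.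
have h2 : (i <= f + 1)%N by nia.
by split; case: e1; lia.
Qed.

Lemma not_asdim_le2 : ~ asdim_le (cayley R genS) 2.
Proof.
have [C normC] := word_norm_le_coord genS.
have [B0 coordB] := coord_le_word_norm genS finS.
(* Corners of a unit cube are at distance at most [C * 2] from its base point; the successor is
   there because balls are open. *)
case/(_ (C * 2).+1%:R (ltr0Sn _ _)) => U [covU [D diamD] multU].
have [d Dd] : exists d : nat, D <= d%:R.
  exists (Num.trunc `|D|).+1; apply: le_trans (ler_norm D) (ltW _).
  by rewrite truncnS_gt.
pose B := (B0 * d)%N.
have sameU V g h : U V -> V g -> V h -> [/\ `|hx h - hx g| <= B%:Z,
    `|hy h - hy g| <= B%:Z & `|hz h - hz g - hx g * (hy h - hy g)| <= B%:Z ^+ 2].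
  move=> UV Vg Vh; rewrite -hz_div -hx_div -hy_div /B PoszM; apply: coordB.
  by rewrite -(@ler_nat R); apply: le_trans Dd; exact: diamD UV g h Vg Vh.
(* No member may join opposite faces. [N] and [L %/ N = N] exceed [B]; [M] exceeds the sum of the
   height bound [B * B], the twist [N * B] and the shears. *)
pose N := B.+1; pose L := (N * N)%N; pose M := (B * B + N * B + 2 * N).+1.
have /choice [c cP] : forall g : heisenberg, exists V, U V /\ V g.
  move=> g; have : (\bigcup_(V in U) V)%classic g by rewrite covU.
  by case=> V UV Vg; exists V.
pose pt := grid_point N.
(* A member is labelled by the lower faces that it touches, with priority to [z], then [y], then
   [x]. Since it does not reach the opposite face, that label is excluded there. *)
pose tx (V : set heisenberg) := `[< exists j k, [/\ (j <= L)%N, (k <= M)%N & V (pt 0 j k)] >].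
pose ty (V : set heisenberg) := `[< exists i k, [/\ (i <= N)%N, (k <= M)%N & V (pt i 0 k)] >].
pose tz (V : set heisenberg) := `[< exists i j, [/\ (i <= N)%N, (j <= L)%N & V (pt i j 0)] >].
pose lab V : nat := if tz V then 3 else if ty V then 2 else if tx V then 1 else 0.
have cE i j k : U (c (pt i j k)) /\ c (pt i j k) (pt i j k) by exact: cP.
have xE i j k : hx (pt i j k) = i%:Z by rewrite /hx grid_point_coord.
have yE i j k : hy (pt i j k) = (j %/ N)%N%:Z by rewrite /hy grid_point_coord.
have zE i j k : hz (pt i j k) = k%:Z - (i * (j %% N) %/ N)%N%:Z.
  by rewrite /hz grid_point_coord.
have zN i j : (i <= N)%N -> (i * (j %% N) %/ N <= N)%N.
  move=> iN; rewrite -[X in (_ <= X)%N](mulnK N (ltn0Sn B)) leq_div2r // leq_mul //.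
  by rewrite ltnW // ltn_mod.
have [|||||||i [j [k [iN jL kM labs]]]] :=
  @cubical_sperner N L M (fun i j k => lab (c (pt i j k))).
- by move=> i j k _ _ _; rewrite /lab; case: (tz _); case: (ty _); case: (tx _).
- move=> j k jL kM; rewrite /lab; do 2!case: ifP => // _.
  rewrite (_ : tx _ = true) //; apply/asboolP; exists j, k; split=> //.
  by have [] := cE 0%N j k.
- move=> j k jL kM; rewrite /lab; do 2!case: ifP => // _.
  case: ifP => // /asboolP [j' [k' [_ _ V0]]]; have [UV V1] := cE N j k.
  by have [+ _ _] := sameU _ _ _ UV V0 V1; rewrite !xE; lia.
- move=> i k iN kM; rewrite /lab; case: ifP => // _.
  rewrite (_ : ty _ = true) //; apply/asboolP; exists i, k; split=> //.
  by have [] := cE i 0%N k.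
- move=> i k iN kM; rewrite /lab; case: ifP => // _.
  case: ifP => [/asboolP|]; last by case: (ty _); case: (tx _).
  case=> i' [k' [_ _ V0]]; have [UV V1] := cE i L k.
  by have [_ + _] := sameU _ _ _ UV V0 V1; rewrite !yE mulnK // div0n; lia.
- move=> i j iN jL; rewrite /lab.
  rewrite (_ : tz _ = true) //; apply/asboolP; exists i, j; split=> //.
  by have [] := cE i j 0%N.
- move=> i j iN jL; rewrite /lab.
  case: ifP => [/asboolP|]; last by case: (ty _); case: (tx _).
  case=> i' [j' [iN' _ V0]]; have [UV V1] := cE i j M.
  have [_ + +] := sameU _ _ _ UV V0 V1; rewrite !zE xE.
  have := zN i j iN; have := zN i' j' iN'.
  set u := (i * _ %/ _)%N; set v := (i' * _ %/ _)%N; set y := hy _ - hy _ => vN uN yB zB.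
  have iy : `|i'%:Z * y| <= N%:Z * B by rewrite normrM ler_pM //; lia.
  have ME : M%:Z = B%:Z ^+ 2 + N%:Z * B + 2 * N%:Z + 1.
    by rewrite /M -addn1 !PoszD !PoszM expr2.
  move: (le_trans (ler_norm _) zB) (le_trans (ler_norm _) iy) => {zB iy}.
  rewrite ME; move: (i'%:Z * y) (N%:Z * B) (B%:Z ^+ 2) => w nb b2.
  by move: u v uN vN => u v uN vN; clear -uN vN; lia.
(* Four labels on one cube come from four distinct members, all meeting the ball at its base
   point. *)
have : (`I_4 #<= `I_3)%card; last by rewrite card_le_II.
apply: card_le_trans (multU (pt i j k)).
apply: card_le_trans (card_image_le lab _); apply: subset_card_le => e /= e4.
have [e1 [e2 [e3 labE]]] := labs e e4.
have [UV V1] := cE (i + e1)%N (j + e2)%N (k + e3)%N.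
exists (c (pt (i + e1) (j + e2) (k + e3))%N) => //; split=> //.
exists (pt (i + e1) (j + e2) (k + e3))%N; split=> //.
rewrite ballEmdist /= /mdist /= /cayley_dist ltr_nat ltnS.
have [dx dy dz] := grid_point_step j k e1 e2 e3 iN.
exact: normC.
Qed.

End LowerBound.

(** * Bricks *)

Section Bricks.
Implicit Types (x y z a b k d e m n w : int).

Lemma divz_bounds x d : 0 < d -> (x %/ d)%Z * d <= x < ((x %/ d)%Z + 1) * d.
Proof.
move=> d0; have := divz_eq x d; have := ltz_pmod x d0.
have := modz_ge0 x (lt0r_neq0 d0); lia.
Qed.

Lemma divz_unique x d n : n * d <= x < (n + 1) * d -> (x %/ d)%Z = n.
Proof.
move=> /andP [lo hi]; have d0 : 0 < d by lia.
have /andP [lo' hi'] := divz_bounds x d0.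
have : n < (x %/ d)%Z + 1 by rewrite -(ltr_pM2r d0); lia.
have : (x %/ d)%Z < n + 1 by rewrite -(ltr_pM2r d0); lia.
lia.
Qed.

Lemma divz_near w w0 d e : 2 * e < d -> `|w - w0| <= e ->
  (w %/ d)%Z = ((w0 - e) %/ d)%Z \/ (w %/ d)%Z = ((w0 + e) %/ d)%Z.
Proof.
move=> ed we; have d0 : 0 < d by lia.
have /andP [a1 a2] := divz_bounds w d0.
have /andP [b1 b2] := divz_bounds (w0 - e) d0.
have /andP [c1 c2] := divz_bounds (w0 + e) d0.
set k := (w %/ d)%Z in a1 a2 *; set k0 := ((w0 - e) %/ d)%Z in b1 b2 *.
set k1 := ((w0 + e) %/ d)%Z in c1 c2 *.
have : k0 < k + 1 by rewrite -(ltr_pM2r d0); lia.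
have : k < k1 + 1 by rewrite -(ltr_pM2r d0); lia.
have : k1 < k0 + 1 + 1 by rewrite -(ltr_pM2r d0); lia.
lia.
Qed.

(** Two cells are seen only from within [e] of the wall [n * d] between them. *)
Lemma divz_jump w0 d e : 2 * e < d -> 0 <= e ->
  ((w0 - e) %/ d)%Z != ((w0 + e) %/ d)%Z ->
  exists2 n, `|w0 - n * d| <= e &
    ((w0 - e) %/ d)%Z = n - 1 /\ ((w0 + e) %/ d)%Z = n.
Proof.
move=> ed e0 /eqP ne; have d0 : 0 < d by lia.
have /andP [b1 b2] := divz_bounds (w0 - e) d0.
have /andP [c1 c2] := divz_bounds (w0 + e) d0.
exists ((w0 + e) %/ d)%Z.
all: set k0 := ((w0 - e) %/ d)%Z in b1 b2 ne *.
all: set k1 := ((w0 + e) %/ d)%Z in c1 c2 ne *.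
all: have h1 : k1 < k0 + 1 + 1 by rewrite -(ltr_pM2r d0); lia.
all: have h2 : k0 < k1 + 1 by rewrite -(ltr_pM2r d0); lia.
all: have e1 : k0 = k1 - 1 by lia.
  by move: b2; rewrite e1 subrK; lia.
by split.
Qed.

(* Columns of bricks stand over the cells of a brick wall in the plane, strips
   of width [L] being staggered by [L / 2]; in each strip the horizontal planes
   are those of the group based at the left edge of the strip.  Crossing into
   the next strip changes these planes by [L y], a multiple of [L ^ 2 / 2] at
   the corners of the wall, so the heights of the floors at a corner differ only
   by the shifts: a proper 3-colouring of the wall keeps them apart. *)
Definition brick_row L a y : int := ((2 * y - a * L) %/ (2 * L))%Z.
Definition brick_shift a b : int := ((b - a) %% 3)%Z.
(** The factor 6 avoids fractions: a brick of height [L ^+ 2 / 2] becomes [3 * L ^+ 2], and each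
    colour shifts by a third of it. *)
Definition brick_height L a b y z : int :=
  6 * (z - a * L * y) - brick_shift a b * L ^+ 2.
Definition brick L x y z : int * int * int :=
  let a := (x %/ L)%Z in let b := brick_row L a y in
  (a, b, (brick_height L a b y z %/ (3 * L ^+ 2))%Z).

(** Moving the base from the strip edge to [x] costs [L ^+ 2] in height. The bound [4 * L ^+ 2] is
    generous and puts the brick in a box of parameter [2 * L]. *)
Lemma brick_diam L x y z x' y' z' : 0 < L -> brick L x y z = brick L x' y' z' ->
  [/\ `|x' - x| <= L, `|y' - y| <= L & `|z' - z - x * (y' - y)| <= 4 * L ^+ 2].
Proof.
move=> L0 [ax]; rewrite -ax; set a := (x %/ L)%Z => bE.
rewrite -bE; set b := brick_row L a y => kE.
have /andP [x1 x2] := divz_bounds x L0; have := divz_bounds x' L0.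
rewrite -ax -/a => /andP [x1' x2']; rewrite -/a in x1 x2.
have L20 : 0 < 2 * L by lia.
have := divz_bounds (2 * y - a * L) L20; have := divz_bounds (2 * y' - a * L) L20.
rewrite -/(brick_row L a y) -/(brick_row L a y') -bE -/b.
move=> /andP [y1' y2'] /andP [y1 y2].
have L30 : 0 < 3 * L ^+ 2 by rewrite mulr_gt0 // exprn_gt0.
have := divz_bounds (brick_height L a b y z) L30.
have := divz_bounds (brick_height L a b y' z') L30.
rewrite -kE; set k := (_ %/ _)%Z; rewrite /brick_height.
move=> /andP [z1' z2'] /andP [z1 z2].
have dx : `|x' - x| <= L by lia.
have dy : `|y' - y| <= L by lia.
split=> //.
have xy : `|(x - a * L) * (y' - y)| <= L ^+ 2 by rewrite normrM expr2 ler_pM //; lia.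
have -> : z' - z - x * (y' - y) =
  (z' - a * L * y') - (z - a * L * y) - (x - a * L) * (y' - y) by ring.
have l2 : 0 <= L ^+ 2 by apply: sqr_ge0.
move: (z' - a * L * y') (z - a * L * y) ((x - a * L) * (y' - y)) z1 z2 z1' z2' xy.
move: (brick_shift a b * L ^+ 2) (L ^+ 2) l2 => s l l2 u v t z1 z2 z1' z2' xy.
by clear -z1 z2 z1' z2' xy l2; lia.
Qed.

End Bricks.

(** * Bricks met by a small box *)

Section BrickMultiplicity.
Variables m x0 y0 z0 : int.
Hypothesis m0 : 0 < m.
(** Here 192 = 6 (1 + 31), where [31 * m = L + m] bounds the distance to the strip edge. The factor
    30 ensures 2 * 192 + 180 < 30^2, the margin for comparing two columns. *)
Let L := 30 * m.
Let e := 192 * m ^+ 2.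
Let P := 3 * L ^+ 2.

Let H a b := brick_height L a b y0 z0.
Let lo a b : int := ((H a b - e) %/ P)%Z.
Let hi a b : int := ((H a b + e) %/ P)%Z.

Let L0 : 0 < L. Proof. by rewrite /L; lia. Qed.
Let m20 : 0 < m ^+ 2. Proof. by rewrite exprn_gt0. Qed.
Let PE : P = 2700 * m ^+ 2. Proof. by rewrite /P /L; ring. Qed.
Let eP : 2 * e < P. Proof. by rewrite PE /e; move: m20; clear; lia. Qed.
Let e0 : 0 <= e. Proof. by rewrite /e; move: m20; clear; lia. Qed.

Let close x y z := [/\ `|x - x0| <= m, `|y - y0| <= m &
  `|z - z0 - x0 * (y - y0)| <= m ^+ 2].

Let height_near b x y z : close x y z ->
  `|brick_height L (x %/ L)%Z b y z - H (x %/ L)%Z b| <= e.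
Proof.
case=> dx dy dz; have := divz_bounds x L0; set a := (x %/ L)%Z => /andP [ax1 ax2].
rewrite /H /brick_height.
have -> : 6 * (z - a * L * y) - brick_shift a b * L ^+ 2
    - (6 * (z0 - a * L * y0) - brick_shift a b * L ^+ 2)
  = 6 * ((z - z0 - x0 * (y - y0)) + (x0 - a * L) * (y - y0)) by ring.
have xa : `|x0 - a * L| <= 31 * m.
  by move: ax2; rewrite mulrDl mul1r; move: (a * L) ax1; rewrite /L; lia.
have : `|(x0 - a * L) * (y - y0)| <= 31 * m ^+ 2.
  by rewrite normrM expr2 mulrA ler_pM.
move: (_ * (y - y0)) (z - z0 - _) dz => u v; rewrite /e.
by move: (m ^+ 2); clear; lia.
Qed.

(** If both columns split, both heights are within [e] of multiples of [P]. Subtracting puts a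
    multiple of [L ^+ 2] within less than [L ^+ 2] of 0; its coefficient is nonzero because the
    shifts differ mod 3. *)
Let not_both_split a b a' b' N : brick_shift a b != brick_shift a' b' ->
  `|6 * L * (a' - a) * y0 - 3 * N * L ^+ 2| <= 180 * m ^+ 2 ->
  lo a b = hi a b \/ lo a' b' = hi a' b'.
Proof.
move=> s_ne dN; case: (eqVneq (lo a b) (hi a b)) => [|/(divz_jump eP e0)]; first by left.
case=> n nP _; case: (eqVneq (lo a' b') (hi a' b')) => [|/(divz_jump eP e0)]; first by right.
case=> n' nP' _; exfalso.
have L2 : L ^+ 2 = 900 * m ^+ 2 by rewrite /L; ring.
pose D := brick_shift a' b' - brick_shift a b + 3 * (N - n + n').
have DE : D * (900 * m ^+ 2) = (H a b - n * P) - (H a' b' - n' * P)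
    - (6 * L * (a' - a) * y0 - 3 * N * L ^+ 2).
  by rewrite /H /brick_height /P /D -L2; ring.
have D0 : D != 0.
  apply/eqP => D0; move: s_ne D0; rewrite /D /brick_shift; clear; lia.
have D1 : 1 <= `|D| by move: D0; clear; lia.
have c0 : 0 < 900 * m ^+ 2 by move: m20; clear; lia.
have : `|D * (900 * m ^+ 2)| < 900 * m ^+ 2.
  rewrite DE; move: nP nP' dN; rewrite /e.
  move: (H a b - _) (H a' b' - _) (_ - 3 * N * _) (m ^+ 2) m20.
  by clear; lia.
by rewrite normrM (gtr0_norm c0) gtr_pMl // ltNge D1.
Qed.

(** At least two of the three columns do not split, so 2 + 1 + 1 bricks suffice. *)
Let corner a1 b1 a2 b2 a3 b3 :
  lo a1 b1 = hi a1 b1 \/ lo a2 b2 = hi a2 b2 ->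
  lo a1 b1 = hi a1 b1 \/ lo a3 b3 = hi a3 b3 ->
  lo a2 b2 = hi a2 b2 \/ lo a3 b3 = hi a3 b3 ->
  exists s : seq (int * int * int), size s = 4 /\ forall a b k,
    (a, b) \in [:: (a1, b1); (a2, b2); (a3, b3)] -> k = lo a b \/ k = hi a b ->
    (a, b, k) \in s.
Proof.
have two c1 d1 c2 d2 c3 d3 : lo c1 d1 = hi c1 d1 -> lo c2 d2 = hi c2 d2 ->
    exists s : seq (int * int * int), size s = 4 /\ forall a b k,
    (a, b) \in [:: (c1, d1); (c2, d2); (c3, d3)] -> k = lo a b \/ k = hi a b ->
    (a, b, k) \in s.
  move=> e1 e2; exists [:: (c1, d1, lo c1 d1); (c2, d2, lo c2 d2);
    (c3, d3, lo c3 d3); (c3, d3, hi c3 d3)]; split=> // a b k.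
  by rewrite !inE => /or3P [] /eqP [-> ->] [] ->; rewrite -?e1 -?e2 eqxx ?orbT.
have perm c1 c2 c3 : (exists s : seq (int * int * int), size s = 4 /\ forall a b k,
    (a, b) \in [:: c1; c2; c3] -> k = lo a b \/ k = hi a b -> (a, b, k) \in s) ->
    perm_eq [:: (a1, b1); (a2, b2); (a3, b3)] [:: c1; c2; c3] ->
    exists s : seq (int * int * int), size s = 4 /\ forall a b k,
    (a, b) \in [:: (a1, b1); (a2, b2); (a3, b3)] -> k = lo a b \/ k = hi a b ->
    (a, b, k) \in s.
  by case=> s [s4 sP] /perm_mem cE; exists s; split=> // a b k; rewrite cE; exact: sP.
case=> E1 E2 E3.
  case: E3 => E3; first exact: perm (two _ _ _ _ a3 b3 E1 E3) _.
  apply: perm (two _ _ _ _ a2 b2 E1 E3) _.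
  by rewrite perm_cons (perm_catC [:: _] [:: _]).
case: E2 => E2; first exact: two.
by apply: perm (two _ _ _ _ a1 b1 E1 E2) _; rewrite (perm_catC [:: _] [:: _; _]).
Qed.

(** With at most two columns, each shows at most two bricks. A third column appears only where a row
    wall of one strip meets the edge of the other, and the stagger allows this in one strip only. *)
Lemma ball_bricks : exists s : seq (int * int * int), size s = 4 /\
  forall x y z, close x y z -> brick L x y z \in s.
Proof.
pose A0 := ((x0 - m) %/ L)%Z; pose A1 := ((x0 + m) %/ L)%Z.
have mL : 2 * m < L by rewrite /L; lia.
have mL4 : 4 * m < L by rewrite /L; lia.
have mL2 : 2 * (2 * m) < 2 * L by rewrite /L; lia.
pose B0 a := ((2 * y0 - a * L - 2 * m) %/ (2 * L))%Z.
pose B1 a := ((2 * y0 - a * L + 2 * m) %/ (2 * L))%Z.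
have inP x y z : close x y z -> exists a b k, [/\ brick L x y z = (a, b, k),
    a = A0 \/ a = A1, b = B0 a \/ b = B1 a & k = lo a b \/ k = hi a b].
  move=> xyz; have [dx dy _] := xyz; rewrite /brick.
  have aP := divz_near mL dx; set a := (x %/ L)%Z in aP *.
  have bP : brick_row L a y = B0 a \/ brick_row L a y = B1 a.
    by apply: divz_near => //; move: dy; clear; lia.
  set b := brick_row L a y in bP *.
  have kP := divz_near eP (height_near b xyz).
  by do 3!eexists; split; eauto.
have [A01|/(divz_jump mL (ltW m0)) [A _ [A0E A1E]]] := eqVneq A0 A1.
  exists [:: (A0, B0 A0, lo A0 (B0 A0)); (A0, B0 A0, hi A0 (B0 A0));
             (A0, B1 A0, lo A0 (B1 A0)); (A0, B1 A0, hi A0 (B1 A0))].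
  split=> // x y z /inP [a [b [k [-> aP bP kP]]]].
  have {aP} aP : a = A0 by case: aP => // ->.
  rewrite {}aP in bP kP *.
  by case: bP kP => -> [] ->; rewrite !inE eqxx ?orbT.
rewrite -/A0 -/A1 in A0E A1E.
have strip a : B0 a != B1 a -> exists2 b, `|2 * y0 - a * L - b * (2 * L)| <= 2 * m &
    B0 a = b - 1 /\ B1 a = b.
  by move/(divz_jump mL2); apply; lia.
have [B01|/strip [b bP [b0 b1]]] := eqVneq (B0 A0) (B1 A0).
  have [B01'|/strip [b bP [b0 b1]]] := eqVneq (B0 A1) (B1 A1).
    exists [:: (A0, B0 A0, lo A0 (B0 A0)); (A0, B0 A0, hi A0 (B0 A0));
             (A1, B1 A1, lo A1 (B1 A1)); (A1, B1 A1, hi A1 (B1 A1))].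
    split=> // x y z /inP [a [b [k [-> [] -> bP kP]]]].
      rewrite -B01 in bP; have {bP} bE : b = B0 A0 by case: bP.
      by move: kP; rewrite {}bE => -[] ->; rewrite !inE eqxx ?orbT.
    rewrite B01' in bP; have {bP} bE : b = B1 A1 by case: bP.
    by move: kP; rewrite {}bE => -[] ->; rewrite !inE eqxx ?orbT.
  (* The row wall of strip [A1] is at mid-height of row [b] of strip [A0]. *)
  have bA0 : B0 A0 = b.
    apply: divz_unique; move: bP; rewrite A1E A0E.
    have -> : (A - 1) * L = A * L - L by ring.
    have -> : (b + 1) * (2 * L) = b * (2 * L) + 2 * L by ring.
    by move: (A * L) (b * (2 * L)); move: mL4 m0; clearbody L; clear; lia.
  (* At this corner [2 * y0] is within [2 * m] of [(A + 2 * b) * L]; multiplying by [3 * L = 90 * m]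
     gives the error [180 * m ^+ 2]. *)
  have yE N : N = A - 1 + 2 * b + 1 -> `|6 * L * y0 - 3 * N * L ^+ 2| <= 180 * m ^+ 2.
    move=> ->; have -> : 6 * L * y0 - 3 * (A - 1 + 2 * b + 1) * L ^+ 2 =
      (90 * m) * (2 * y0 - A1 * L - b * (2 * L)) by rewrite A1E /L; ring.
    have -> : 180 * m ^+ 2 = 90 * m * (2 * m) by ring.
    by rewrite normrM gtr0_norm 1?ler_pM2l //; move: m0; clear; lia.
  have [|||s [s4 sP]] := @corner A0 b A1 (b - 1) A1 b.
  - apply: (@not_both_split _ _ _ _ (A - 1 + 2 * b + 1)).
      by rewrite /brick_shift A0E A1E; clear; lia.
    by have -> : A1 - A0 = 1 by [lia]; rewrite mulr1; exact: yE.
  - apply: (@not_both_split _ _ _ _ (A - 1 + 2 * b + 1)).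
      by rewrite /brick_shift A0E A1E; clear; lia.
    by have -> : A1 - A0 = 1 by [lia]; rewrite mulr1; exact: yE.
  - apply: (@not_both_split _ _ _ _ 0); first by rewrite /brick_shift; clear; lia.
    by rewrite subrr !(mulr0, mul0r) subrr normr0; move: m20; clear; lia.
  exists s; split=> // x y z /inP [a [b' [k [-> aP bP' kP]]]]; apply: sP kP.
  case: aP bP' => ->; rewrite ?b0 ?b1 -?B01 ?bA0 => -[] ->; by rewrite !inE eqxx ?orbT.
(* Mirror case: the row wall is in strip [A0], at mid-height of row [b - 1] of strip [A1]. *)
have bA1 c : `|2 * y0 - A1 * L - 2 * L * b + L| <= 2 * m ->
    c = - (2 * m) \/ c = 2 * m -> ((2 * y0 - A1 * L + c) %/ (2 * L))%Z = b - 1.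
  move=> yb cm; apply: divz_unique; move: yb cm.
  have -> : (b - 1) * (2 * L) = 2 * L * b - 2 * L by ring.
  have -> : (b - 1 + 1) * (2 * L) = 2 * L * b by ring.
  by move: (A1 * L) (2 * L * b); move: mL4 m0; clearbody L; clear; lia.
have yb : `|2 * y0 - A1 * L - 2 * L * b + L| <= 2 * m.
  have -> // : 2 * y0 - A1 * L - 2 * L * b + L = 2 * y0 - A0 * L - b * (2 * L).
  by rewrite A0E A1E; ring.
have B0A1 : B0 A1 = b - 1 by apply: bA1 => //; left.
have B1A1 : B1 A1 = b - 1 by apply: bA1 => //; right.
have yE : `|6 * L * y0 - 3 * (A - 1 + 2 * b) * L ^+ 2| <= 180 * m ^+ 2.
  have -> : 6 * L * y0 - 3 * (A - 1 + 2 * b) * L ^+ 2 =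
    (90 * m) * (2 * y0 - A0 * L - b * (2 * L)) by rewrite A0E /L; ring.
  have -> : 180 * m ^+ 2 = 90 * m * (2 * m) by ring.
  by rewrite normrM gtr0_norm 1?ler_pM2l //; move: m0; clear; lia.
have A01E : A1 - A0 = 1 by rewrite A0E A1E; ring.
have [|||s [s4 sP]] := @corner A0 b A0 (b - 1) A1 (b - 1).
- apply: (@not_both_split _ _ _ _ 0); first by rewrite /brick_shift; clear; lia.
  by rewrite subrr !(mulr0, mul0r) subrr normr0; move: m20; clear; lia.
- apply: (@not_both_split _ _ _ _ (A - 1 + 2 * b)).
    by rewrite /brick_shift A0E A1E; clear; lia.
  by rewrite A01E mulr1; exact: yE.
- apply: (@not_both_split _ _ _ _ (A - 1 + 2 * b)).
    by rewrite /brick_shift A0E A1E; clear; lia.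
  by rewrite A01E mulr1; exact: yE.
exists s; split=> // x y z /inP [a [b' [k [-> aP bP' kP]]]]; apply: sP kP.
by case: aP bP' => ->; rewrite ?b0 ?b1 ?B0A1 ?B1A1 => -[] ->; rewrite !inE eqxx ?orbT.
Qed.

End BrickMultiplicity.

(** * Upper bound *)

Section UpperBound.
Local Open Scope classical_set_scope.

(** The members are the fibres of [f], so those met by a ball are counted by the values of [f] on
    it. *)
Lemma fibre_cover (R : realType) (X : metricType R) (T : eqType) (f : X -> T)
    (r D : R) (n : nat) :
  (forall x y, f x = f y -> mdist x y <= D) ->
  (forall x, exists s : seq T, (size s <= n)%N /\
    forall y, mdist x y < r -> f y \in s) ->
  exists C : set (set X), [/\ is_cover C, forall U, C U -> diam_le D U &
    ball_multiplicity_le C r n].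
Proof.
move=> diamf multf; exists (range (fun t => f @^-1` [set t]))%classic; split.
- rewrite /is_cover -subTset => x _; exists (f @^-1` [set f x])%classic => //.
- by move=> _ [t _ <-] x y /= xt yt; apply: diamf; rewrite xt yt.
move=> x; have [s [sn sP]] := multf x.
apply: card_le_trans (card_image_le (fun i => f @^-1` [set nth (f x) s i])%classic `I_n).
apply: subset_card_le => _ /= [[t _ <-] [y [xy /= yt]]].
rewrite ballEmdist /= in xy; have ys := sP y xy.
exists (index (f y) s); first by rewrite /= (leq_trans _ sn) // index_mem.
by rewrite nth_index // yt.
Qed.

Variables (R : realType) (S : set heisenberg) (genS : generates S).
Hypothesis finS : finite_set S.

Lemma dimAN_le3 : dimAN_le (cayley R genS) 3.
Proof.
have [C normC] := word_norm_le_coord genS.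
have [B coordB] := coord_le_word_norm genS finS.
(* A brick fits in a box of parameter [2 * L = 60 * B.+1 * n] with [n <= r]; the successor keeps the
   constant positive. *)
exists (C * (60 * B.+1)).+1%:R; first exact: ltr0Sn.
move=> r r0; set K : R := _%:R.
have K0 : 0 <= K * r by rewrite mulr_ge0 // ltW.
(* Below radius 1 balls are points, and singletons cover. *)
have [r1|r1] := ltP r 1.
  apply: (@fibre_cover _ _ _ id) => [x _ <-|x]; first by rewrite mdistxx.
  exists [:: x]; split=> // y xy; rewrite inE; apply/eqP/esym.
  have := lt_trans xy r1; rewrite /mdist /= /cayley_dist -[X in _ < X]/(1%:R).
  rewrite ltr_nat ltnS leqn0.
  by move/eqP/word_dist_eq0.
pose n := Num.trunc r; have n0 : (0 < n)%N by rewrite truncn_gt0.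
have nr : n%:R <= r by rewrite truncn_le ltW.
(* This [m] bounds the coordinates of elements of norm at most [n]; [B.+1] keeps it positive even if
   [B] is 0. *)
pose m := (B.+1 * n)%N; have m0 : (0 < m%:Z) by rewrite ltz_nat muln_gt0.
pose L : int := 30 * m%:Z; have L0 : 0 < L by rewrite /L; lia.
apply: (@fibre_cover _ _ _ (fun g : cayley R genS => brick L (hx g) (hy g) (hz g))).
  move=> g h /(brick_diam L0) [dx dy dz].
  apply: (@le_trans _ _ (C * (60 * m))%N%:R).
    rewrite /mdist /= /cayley_dist ler_nat; apply: normC.
    - by rewrite muln_gt0.
    - by rewrite hx_div; move: dx; rewrite /L; lia.
    - by rewrite hy_div; move: dy; rewrite /L; lia.
    - rewrite hz_div (le_trans dz) // /L; have -> : (60 * m)%N%:Z = 2 * (30 * m%:Z) by lia.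
      by rewrite [leRHS](_ : _ = 4 * (30 * m%:Z) ^+ 2) //; ring.
  rewrite /m !mulnA natrM ler_pM //; rewrite /K ler_nat; lia.
move=> g; have [s [s4 sP]] := ball_bricks (hx g) (hy g) (hz g) m0.
exists s; split; first by rewrite s4.
move=> h gh; apply: sP.
have gn : (word_norm genS (g^-1 * h)%g <= n)%N.
  by rewrite -ltnS -(@ltr_nat R) (lt_trans gh) // truncnS_gt.
have [] := coordB _ _ gn; rewrite hx_div hy_div hz_div => dx dy dz.
have mB : B%:Z * n <= m%:Z by rewrite /m; lia.
have mB2 : (B%:Z * n) ^+ 2 <= m%:Z ^+ 2 by rewrite lerXn2r // nnegrE //; lia.
by split; apply: le_trans; eauto.
Qed.

End UpperBound.

(** * From the two bounds to the dimensions *)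

Lemma least_dimE (P : nat -> Prop) n :
  P n -> (forall m, (m < n)%N -> ~ P m) -> least_dim P = Some n.
Proof.
move=> Pn minP; rewrite /least_dim; case: pselect => [exP|[]]; last first.
  by exists n; apply/asboolP.
case: ex_minnP => m /asboolP Pm mP; congr Some.
have mn : (m <= n)%N by apply: mP; apply/asboolP.
by have [/minP|nm] := ltnP m n; [|apply: anti_leq; rewrite mn nm].
Qed.

Lemma asdim_le_mono (R : realType) (X : metricType R) m n :
  (m <= n)%N -> asdim_le X m -> asdim_le X n.
Proof.
move=> mn dimX r /dimX [C [covC diamC multC]]; exists C; split=> // x.
by apply: card_le_trans (multC x) _; rewrite card_le_II.
Qed.

Lemma dimAN_asdim_le (R : realType) (X : metricType R) n :
  dimAN_le X n -> asdim_le X n.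
Proof.
move=> [K _ dimX] r /dimX [C [covC diamC multC]]; exists C; split=> //.
by exists (K * r).
Qed.

Theorem proposition5p1 (R : realType) (S : set heisenberg)
    (finS : finite_set S) (genS : generates S) :
  asdim (cayley R genS) = Some 3%N /\ dimAN (cayley R genS) = Some 3%N.
Proof.
have lower m : (m < 3)%N -> ~ asdim_le (cayley R genS) m.
  by move=> m3 /(@asdim_le_mono _ _ _ 2 m3); exact: not_asdim_le2.
have upper := dimAN_le3 R genS finS.
split; apply: least_dimE => //; first exact: dimAN_asdim_le.
by move=> m m3 /dimAN_asdim_le; exact: lower.
Qed.
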